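(* Let $A$ be a Fréchet space of sequences as in the context, with topology given by an increasing sequence of seminorms $(p_n)_{n\ge1}$, let $X$ be a separable topological vector space whose topology is given by an increasing sequence of seminorms $(q_j)_{j\ge1}$, let $(x_n)_{n\ge0}$ be a sequence in $X$, and let $S_k:A\to X$, $S_k((a_n)_{n\ge0})=\sum_{n=0}^ka_nx_n$. Suppose that $X$ possesses a continuous norm and that for any $n\ge1$, $\ker p_n$ is a subspace of finite codimension of $A$. Then the sequence $(S_k)_{k\ge 0}$ possesses a hypercyclic subspace if and only if for any $N\ge0$, $$\bigcup_{M\ge N}\Big(\mathrm{span}\{x_k:N\le k\le M\}\cap\mathrm{span}\{x_k:M+1\le k\}\Big)$$ is dense in $X$.
   Context: $\mathbb{K}=\mathbb{R}$ or $\mathbb{C}$. $A$ is a Fréchet space that is a subspace of $\mathbb{K}^{\mathbb{Z}_+}$ (sequences indexed by non-negative integers) such that the coordinate projections $A\to\mathbb{K}$, $(a_n)_{n\ge0}\mapsto a_m$, are continuous for all $m\ge0$ and such that the set of polynomials (finitely supported sequences) is contained and dense in $A$. A vector $a\in A$ is hypercyclic for $(S_k)$ if $\{S_ka\}_k$ is dense in $X$; a hypercyclic subspace for $(S_k)$ is a closed infinite-dimensional subspace of $A$ in which every non-zero vector is hypercyclic for $(S_k)$. *)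

(* Defs.v *)
From HB Require Import structures.
From mathcomp Require Import all_boot all_order all_algebra.
From mathcomp Require Export complex.
From mathcomp Require Import all_classical all_reals all_analysis.

Set Implicit Arguments.
Unset Strict Implicit.
Unset Printing Implicit Defensive.

Import Order.TTheory GRing.Theory Num.Theory.

Local Open Scope classical_set_scope.
Local Open Scope ring_scope.

Section LinearAlgebra.
Context {K : numFieldType} {V : lmodType K}.
Implicit Types (B W : set V).

Definition lspan B : set V :=
  [set v | exists (n : nat) (c : 'I_n -> K) (b : 'I_n -> V),
     (forall i, B (b i)) /\ v = \sum_(i < n) c i *: b i].

Definition linear_subspace W : Prop :=
  W 0 /\ forall (c : K) (u v : V), W u -> W v -> W (c *: u + v).

Definition finite_dim W : Prop :=
  exists2 B, finite_set B & W = lspan B.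

(* The quotient of V by W is spanned by the classes of finitely many vectors. *)
Definition finite_codim W : Prop :=
  exists2 B, finite_set B & forall v, exists2 w, W w & lspan B (v - w).

(* As for the library's norms, values are elements of K; being nonnegative they
   are real, also when K is the field of complex numbers. *)
Definition seminorm (p : V -> K) : Prop :=
  [/\ forall u, 0 <= p u,
      forall u v, p (u + v) <= p u + p v &
      forall (c : K) u, p (c *: u) = `|c| * p u].

Definition norm (p : V -> K) : Prop :=
  seminorm p /\ forall u, p u = 0 -> u = 0.

Definition seminorm_ker (p : V -> K) : set V := [set u | p u = 0].

End LinearAlgebra.

Section TopologicalVectorSpaces.
Context {K : numFieldType}.

(* Because the sequence increases, the balls of the single seminorms already
   form a base of neighbourhoods. *)
Definition topology_given_by (V : topologicalLmodType K) (p : nat -> V -> K) :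
    Prop :=
  [/\ forall n, seminorm (p n),
      forall n u, p n u <= p n.+1 u &
      forall u : V, nbhs u = filter_from [set ne : nat * K | 0 < ne.2]
                               (fun ne => [set v | p ne.1 (v - u) < ne.2])].

(* Completeness refers to the translation-invariant uniformity, which is
   determined by the topology.  The uniformity of a [tvsType] is only required
   to be compatible with the topology, hence it is not used here. *)
Definition tvs_cauchy (V : topologicalLmodType K) (F : set_system V) : Prop :=
  forall U : set V, nbhs 0 U ->
    exists2 B, F B & forall u v, B u -> B v -> U (u - v).

Definition tvs_complete (V : topologicalLmodType K) : Prop :=
  forall F : set_system V, ProperFilter F -> tvs_cauchy F ->
    exists l : V, F --> l.

Definition frechet_space (V : topologicalLmodType K) : Prop :=
  [/\ hausdorff_space V, tvs_complete V &
      exists p : nat -> V -> K, topology_given_by p].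

Definition separable (T : topologicalType) : Prop :=
  exists2 D : set T, countable D & dense D.

Definition has_continuous_norm (V : topologicalLmodType K) : Prop :=
  exists2 p : V -> K, norm p & continuous (p : V -> K^o).

Definition finitely_supported (s : nat -> K) : Prop :=
  finite_set [set n | s n != 0].

(* A is a space of sequences: [coef a] is the sequence that the vector a is,
   so A is identified, as a vector space, with the range of [coef]. *)
Definition frechet_sequence_space (A : topologicalLmodType K)
    (coef : A -> nat -> K) : Prop :=
  [/\ frechet_space A,
      forall (c : K) (a b : A) m,
        coef (c *: a + b) m = c * coef a m + coef b m,
      injective coef &
      [/\ forall m, continuous ((fun a => coef a m) : A -> K^o),
          forall s, finitely_supported s -> exists a, coef a = s &
          dense [set a | finitely_supported (coef a)]]].

End TopologicalVectorSpaces.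

Section Hypercyclicity.
Context {K : numFieldType} {A X : topologicalLmodType K}.

Definition hypercyclic_vector (S : nat -> A -> X) (a : A) : Prop :=
  dense (range (fun k => S k a)).

Definition hypercyclic_subspace (S : nat -> A -> X) (W : set A) : Prop :=
  [/\ linear_subspace W, closed W, ~ finite_dim W &
      forall a, W a -> a != 0 -> hypercyclic_vector S a].

Definition partial_sum (coef : A -> nat -> K) (x : nat -> X) (k : nat) (a : A) :
    X :=
  \sum_(n < k.+1) coef a n *: x n.

End Hypercyclicity.

(* Main.v *)
Require Import Defs.
From mathcomp Require Import all_boot all_order all_algebra.
From mathcomp Require Import all_classical all_reals all_analysis.

(** Since every [ker p_n] has finite codimension, [A] is, as a topological
    vector space, the space of all scalar sequences with the topology of
    coordinatewise convergence.  Indeed, let [H_d] be the space of sequences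
    whose first [d] terms vanish.  Modulo [ker p_n], the decreasing sequence
    [H_d] is stationary; completeness turns an element of the stationary value
    into a limit all of whose coordinates vanish, hence [H_d] is contained in
    [ker p_n] for some [d] ([tail_space_sub_ker]).  So a series of vectors of
    [A] converges as soon as the orders of its terms tend to infinity
    ([entries_surjective], [closed_entries_approx]).

    Necessity.  Suppose that for some [N] an open set [O] misses all the
    intersections of spans.  If [u] in the hypercyclic subspace has order at
    least [N] and [S_k u] lies in [O], then [S_m u] cannot vanish for [m >= k],
    because otherwise [S_k u] would be a combination of the [x_j], [j > k]
    ([eventually_nonzero]).  The subspace contains nonzero [u_j] of order at
    least [N + j], and a sum of multiples [c_j u_j], with each [c_j] so large
    that the term added last dominates the continuous norm of every partial sum
    it affects, has all its partial sums either zero or of norm at least [b].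
    For a suitable [b] this vector, which the closed subspace contains, never
    visits the part of [O] inside the ball of radius [b].

    Sufficiency.  Density of the intersections yields finitely supported blocks
    with total sum zero, of arbitrarily large order, one of whose partial sums
    is near a prescribed vector ([block_exists]).  Place such blocks one after
    the other and distribute them over infinitely many classes so that the
    intermediate sums of each class are dense.  The sequences that are, on each
    class, a multiple of the concatenated blocks form a closed
    infinite-dimensional subspace ([block_subspace]).  As complete blocks sum to
    zero, the partial sum in the middle of a block only sees this block, so a
    nonzero multiplier on one class makes the vector hypercyclic. *)

Import Order.TTheory GRing.Theory Num.Theory.
Local Open Scope classical_set_scope.
Local Open Scope ring_scope.

(** * Spans, finite codimension and descending chains *)

Section LinearDependence.
Set Implicit Arguments.
Unset Strict Implicit.
Context {K : numFieldType} {V : lmodType K}.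
Implicit Types (B W U : set V).

Lemma linear_subspace0 W : linear_subspace W -> W 0.
Proof. by case. Qed.

Lemma linear_subspaceZ W c u : linear_subspace W -> W u -> W (c *: u).
Proof. by move=> [W0 lW] Wu; rewrite -[_ *: _]addr0; exact: lW. Qed.

Lemma linear_subspaceD W u v : linear_subspace W -> W u -> W v -> W (u + v).
Proof. by move=> [_ lW] Wu Wv; rewrite -[u]scale1r; exact: lW. Qed.

Lemma linear_subspaceN W u : linear_subspace W -> W u -> W (- u).
Proof. by move=> lW Wu; rewrite -scaleN1r; exact: linear_subspaceZ. Qed.

Lemma linear_subspace_sum W (I : Type) (r : seq I) (P : pred I) (c : I -> K)
    (u : I -> V) :
  linear_subspace W -> (forall i, P i -> W (u i)) ->
  W (\sum_(i <- r | P i) c i *: u i).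
Proof.
move=> lW Wu; apply: (big_ind W); first exact: linear_subspace0.
  by move=> a b; exact: linear_subspaceD.
by move=> i Pi; apply: linear_subspaceZ => //; exact: Wu.
Qed.

Lemma lspan_min W B : linear_subspace W -> B `<=` W -> lspan B `<=` W.
Proof.
move=> lW BW _ [n [c [b [Bb ->]]]].
by apply: linear_subspace_sum => // i _; exact/BW/Bb.
Qed.

Lemma lspan_sub B : B `<=` lspan B.
Proof.
move=> b Bb; exists 1%N, (fun=> 1), (fun=> b); split => //.
by rewrite big_ord1 scale1r.
Qed.

Lemma linear_subspace_lspan B : linear_subspace (lspan B).
Proof.
split.
  by exists 0%N, (fun=> 0), (fun=> 0); rewrite big_ord0; split => // -[].
move=> c _ _ [n [a [u [Bu ->]]]] [m [b [v [Bv ->]]]].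
exists (n + m)%N,
  (fun i => match fintype.split i with inl j => c * a j | inr j => b j end),
  (fun i => match fintype.split i with inl j => u j | inr j => v j end).
split; first by move=> i; case: fintype.split.
rewrite big_split_ord /= scaler_sumr; congr (_ + _); apply: eq_bigr => i _.
  by rewrite (unsplitK (inl i : 'I_n + 'I_m)) scalerA.
by rewrite (unsplitK (inr i : 'I_n + 'I_m)).
Qed.

Lemma lspan0 B : lspan B 0.
Proof. exact: linear_subspace0 (linear_subspace_lspan B). Qed.

Lemma lspan_mono B B' : B `<=` B' -> lspan B `<=` lspan B'.
Proof.
move=> BB'; apply: lspan_min; first exact: linear_subspace_lspan.
exact: subset_trans BB' (@lspan_sub _).
Qed.

Lemma lspan_finite_coordinates B : finite_set B ->
  exists (b : nat) (e : 'I_b -> V), forall v, lspan B v ->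
    exists r : 'I_b -> K, v = \sum_(j < b) r j *: e j.
Proof.
move=> /finite_seqP[s ->]; exists (size s), (fun j => nth 0 s j).
apply: lspan_min => [|v /= sv].
  split; first by exists (fun=> 0); rewrite big1// => i _; rewrite scale0r.
  move=> c _ _ [r ->] [t ->]; exists (fun j => c * r j + t j).
  rewrite scaler_sumr -big_split; apply: eq_bigr => j _ /=.
  by rewrite scalerDl scalerA.
have iv : (index v s < size s)%N by rewrite index_mem.
exists (fun j => (j == Ordinal iv)%:R).
rewrite (bigD1 (Ordinal iv))//= eqxx scale1r nth_index// big1 ?addr0// => j.
by move=> /negPf ->; rewrite scale0r.
Qed.

Lemma lspan_finite_dependent B : finite_set B ->
  exists b, forall v : 'I_b -> V, (forall i, lspan B (v i)) ->
    exists2 c : 'I_b -> K, (exists i, c i != 0) & \sum_(i < b) c i *: v i = 0.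
Proof.
move=> /lspan_finite_coordinates[b [e Be]]; exists b.+1 => v Bv.
have [r vr] := choice (fun i => Be _ (Bv i)).
pose M : 'M[K]_(b.+1, b) := \matrix_(i, j) r i j.
have : kermx M != 0.
  rewrite kermx_eq0 /row_free neq_ltn; apply/orP; left.
  by rewrite ltnS rank_leq_col.
case/rowV0Pn => c /sub_kermxP cM c0; exists (c 0).
  exact/rV0Pn.
transitivity (\sum_(j < b) (c *m M) 0 j *: e j).
  under eq_bigr do rewrite vr scaler_sumr.
  rewrite exchange_big /=; apply: eq_bigr => j _.
  rewrite mxE scaler_suml; apply: eq_bigr => i _.
  by rewrite mxE scalerA.
by rewrite cM big1// => j _; rewrite mxE scale0r.
Qed.

Lemma finite_codim_dependent U : linear_subspace U -> finite_codim U ->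
  exists b, forall v : 'I_b -> V,
    exists2 c : 'I_b -> K, (exists i, c i != 0) & U (\sum_(i < b) c i *: v i).
Proof.
move=> lU [B /lspan_finite_dependent[b Bb] BU]; exists b => v.
have /choice[w Uw] : forall u, exists w, U w /\ lspan B (u - w).
  by move=> u; have [w ? ?] := BU u; exists w.
have [c c0 cv] := Bb (fun i => v i - w (v i)) (fun i => (Uw (v i)).2).
exists c => //.
rewrite (_ : \sum_(i < b) _ = \sum_(i < b) c i *: w (v i)).
  by apply: linear_subspace_sum => // i _; case: (Uw (v i)).
apply/eqP; rewrite -subr_eq0 -sumrB -[X in _ == X]cv; apply/eqP.
by apply: eq_bigr => i _; rewrite scalerBr.
Qed.

(** Vectors taken one at each strict drop of the chain are independent modulo
    [U], so there are only finitely many drops. *)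
Lemma finite_codim_chain_stable U (H : nat -> set V) :
  linear_subspace U -> finite_codim U ->
  (forall d, linear_subspace (H d)) ->
  (forall d e, (d <= e)%N -> H e `<=` H d) ->
  exists d, forall e h, H d h -> exists2 g, H e g & U (h - g).
Proof.
move=> lU /(finite_codim_dependent lU)[b Ub] lH Hle; apply: contrapT => nst.
have drop d : exists eh : nat * V, H d eh.2 /\
    forall g, H eh.1 g -> ~ U (eh.2 - g).
  apply: contrapT => nd; apply: nst; exists d => e h dh.
  apply: contrapT => ng; apply: nd; exists (e, h); split => //= g eg Ug.
  by apply: ng; exists g.
have {drop} [nh Hnh] := choice drop.
pose e i := iter i (fun d => (nh d).1) 0%N.
have lt_e i : (e i < e i.+1)%N.
  rewrite ltnNge; apply/negP => ei; have [h1 h2] := Hnh (e i).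
  apply: (h2 (nh (e i)).2); last by rewrite subrr; exact: linear_subspace0.
  exact: Hle h1.
have le_e i j : (i <= j)%N -> (e i <= e j)%N.
  by apply: (homo_leq leqnn leq_trans) => k; exact: ltnW.
have [c [i0 ci0] Uc] := Ub (fun i : 'I_b => (nh (e i)).2).
(* The first vector of a dependence relation is a combination, modulo U, of
   the later ones, which lie below the drop at which it was chosen. *)
have [i ci imin] : exists2 i, c i != 0 & forall j, c j != 0 -> (i <= j)%N.
  case: (@arg_minnP _ i0 (fun i => c i != 0) (fun i => i : nat)) => // i.
  by exists i.
pose g := - (c i)^-1 *: \sum_(j < b | (i < j)%N) c j *: (nh (e j)).2.
have Hg : H (e i.+1) g.
  apply: linear_subspaceZ => //; apply: linear_subspace_sum => // j ij.
  by apply: (Hle _ (e j)); [exact: le_e|case: (Hnh (e j))].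
apply: ((Hnh (e i)).2 g Hg).
suff -> : (nh (e i)).2 - g = (c i)^-1 *: \sum_(j < b) c j *: (nh (e j)).2.
  exact: linear_subspaceZ.
rewrite (bigD1 i) //= scalerDr scalerA mulVf// scale1r; congr (_ + _).
rewrite /g scaleNr opprK; congr (_ *: _).
rewrite [RHS](bigID (fun j : 'I_b => (i < j)%N)) /= [X in _ = _ + X]big1.
  by rewrite addr0; apply: eq_bigl => j; rewrite -val_eqE /=; case: ltngtP.
move=> j /andP[ji]; rewrite -leqNgt => le_ji.
suff /eqP -> : c j == 0 by rewrite scale0r.
apply: contraNT ji => cj; apply/eqP/val_inj/eqP.
by rewrite eqn_leq le_ji imin.
Qed.

(** A vector at which [f] does not vanish and a spanning set of the kernel
    together span [W]. *)
Lemma infinite_dim_ker W (f : V -> K) :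
  linear_subspace W -> (forall c u v, f (c *: u + v) = c * f u + f v) ->
  ~ finite_dim W -> ~ finite_dim (W `&` [set u | f u = 0]).
Proof.
move=> lW lf nW [B finB WB]; apply: nW.
have [f0|] := pselect (W `<=` [set u | f u = 0]).
  by exists B => //; rewrite -WB setIidl.
move=> /existsNP[w /not_implyP[Ww /eqP fw]].
exists (B `|` [set w]); first by rewrite finite_setU.
apply/seteqP; split=> [u Wu|].
  have : lspan B (- (f u / f w) *: w + u).
    rewrite -WB; split; first by apply: lW.2.
    by rewrite /= lf mulNr -mulrA mulVf// mulr1 addNr.
  move=> /(lspan_mono (@subsetUl _ B [set w])) Bu.
  rewrite (_ : u = (f u / f w) *: w + (- (f u / f w) *: w + u)); last first.
    by rewrite addrA scaleNr subrr add0r.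
  apply: (linear_subspace_lspan _).2 Bu.
  by apply: lspan_sub; right.
apply: lspan_min => // u [Bu|-> //].
by have := lspan_sub Bu; rewrite -WB => -[].
Qed.

End LinearDependence.

(** * Topologies given by increasing seminorms *)

Section Seminorms.
Set Implicit Arguments.
Unset Strict Implicit.
Context {K : numFieldType} {V : lmodType K} {p : V -> K}.
Context (sp : seminorm p).

Lemma seminorm_ge0 u : 0 <= p u. Proof. by case: sp. Qed.

Lemma seminormZ c u : p (c *: u) = `|c| * p u. Proof. by case: sp. Qed.

Lemma seminorm0 : p 0 = 0.
Proof. by rewrite -(scale0r 0) seminormZ normr0 mul0r. Qed.

Lemma seminormN u : p (- u) = p u.
Proof. by rewrite -scaleN1r seminormZ normrN1 mul1r. Qed.

Lemma seminormB u v : p (u - v) = p (v - u).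
Proof. by rewrite -seminormN opprB. Qed.

Lemma seminorm_triangle v u w : p (u - w) <= p (u - v) + p (v - w).
Proof.
have -> : u - w = (u - v) + (v - w) by rewrite addrA subrK.
by case: sp.
Qed.

Lemma linear_subspace_seminorm_ker : linear_subspace (seminorm_ker p).
Proof.
split; first exact: seminorm0.
rewrite /seminorm_ker => c u v /= pu pv; apply/eqP.
rewrite eq_le seminorm_ge0 andbT; case: sp => _ /(_ (c *: u) v) pD _.
by rewrite (le_trans pD)// seminormZ pu pv mulr0 addr0.
Qed.

Lemma seminorm_eq0 u : (forall e, 0 < e -> p u < e) -> p u = 0.
Proof.
move=> pe; apply/eqP; apply: contraT => pu0.
by have := pe (p u); rewrite ltxx lt0r pu0 seminorm_ge0 => /(_ isT).
Qed.

End Seminorms.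

Section SeminormTopology.
Set Implicit Arguments.
Unset Strict Implicit.
Context {K : numFieldType} {V : topologicalLmodType K} {p : nat -> V -> K}.
Context (hp : topology_given_by p).

Lemma topology_seminorm n : seminorm (p n). Proof. by case: hp. Qed.

Lemma nbhs_seminormP (u : V) (U : set V) :
  nbhs u U <-> exists n e, 0 < e /\ forall v, p n (v - u) < e -> U v.
Proof.
case: hp => _ _ ->; split=> [[[n e] /= e0 eU]|[n [e [e0 eU]]]].
  by exists n, e; split.
by exists (n, e).
Qed.

Lemma le_seminorm n m u : (n <= m)%N -> p n u <= p m u.
Proof.
case: hp => _ ple _; move: n m.
exact: (@homo_leq _ (p^~ u) (fun y z : K => y <= z) (@lexx _ _)
  (@le_trans _ _)).
Qed.

Lemma seminorm_ker_mono n m u : (n <= m)%N -> p m u = 0 -> p n u = 0.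
Proof.
move=> nm pu; apply/eqP.
by rewrite eq_le (seminorm_ge0 (topology_seminorm n)) andbT -pu le_seminorm.
Qed.

(** Modulo each kernel the sequence is eventually constant, hence it is
    Cauchy; its limit agrees with it modulo that kernel. *)
Lemma limit_mod_kernels (v : nat -> V) : tvs_complete V ->
  (forall n, p n (v n.+1 - v n) = 0) -> exists l, forall n, p n (l - v n) = 0.
Proof.
move=> complV vS.
have vle n j : (n <= j)%N -> p n (v j - v n) = 0.
  have pvv k i : p k (v i - v i) = 0.
    by rewrite subrr (seminorm0 (topology_seminorm _)).
  elim: j => [|j IH]; first by rewrite leqn0 => /eqP ->.
  rewrite leq_eqVlt => /predU1P[-> //|]; rewrite ltnS => nj; apply/eqP.
  rewrite eq_le (seminorm_ge0 (topology_seminorm n)) andbT.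
  rewrite (le_trans (seminorm_triangle (topology_seminorm n) (v j) _ _))//.
  by rewrite IH// (seminorm_ker_mono nj (vS j)) addr0.
have cauchy : tvs_cauchy (v @ \oo).
  move=> U /nbhs_seminormP[n [e [e0 eU]]].
  exists [set v j | j in [set j | (n <= j)%N]].
    by exists n => // j /= nj; exists j.
  move=> _ _ [i /= ni <-] [j /= nj <-]; apply: eU; rewrite subr0.
  rewrite (le_lt_trans (seminorm_triangle (topology_seminorm n) (v n) _ _))//.
  by rewrite (seminormB (topology_seminorm n) (v n)) !vle ?addr0.
have [l vl] := complV _ (fmap_proper_filter v _) cauchy.
exists l => n; apply: (seminorm_eq0 (topology_seminorm n)) => e e0.
have : nbhs l [set u | p n (u - l) < e] by apply/nbhs_seminormP; exists n, e.
move=> /vl[k _ /(_ (maxn n k))] /(_ (leq_maxr _ _)) /= vkl.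
apply: le_lt_trans.
  exact: (seminorm_triangle (topology_seminorm n) (v (maxn n k))).
by rewrite vle ?leq_maxl// addr0 (seminormB (topology_seminorm n)).
Qed.

End SeminormTopology.

(** * The topology of A is that of coordinatewise convergence *)

Definition tail_space {K : numFieldType} {A : lmodType K} (coef : A -> nat -> K)
    (d : nat) : set A :=
  [set a | forall m, (m < d)%N -> coef a m = 0].

Section SequenceSpace.
Set Implicit Arguments.
Unset Strict Implicit.
Context {K : numFieldType} {A : topologicalLmodType K} {coef : A -> nat -> K}.
Context (hA : frechet_sequence_space coef).

Lemma entry_linear c a b m : coef (c *: a + b) m = c * coef a m + coef b m.
Proof. by case: hA. Qed.

Lemma entry0 m : coef 0 m = 0.
Proof.
have /eqP := entry_linear (-1) 0 0 m.
by rewrite scaler0 addr0 mulN1r addNr => /eqP.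
Qed.

Lemma entryZ c a m : coef (c *: a) m = c * coef a m.
Proof. by rewrite -[c *: a]addr0 entry_linear entry0 addr0. Qed.

Lemma entryD a b m : coef (a + b) m = coef a m + coef b m.
Proof. by rewrite -[a]scale1r entry_linear mul1r scale1r. Qed.

Lemma entryB a b m : coef (a - b) m = coef a m - coef b m.
Proof. by rewrite entryD -scaleN1r entryZ mulN1r. Qed.

Lemma entry_sum n (c : 'I_n -> K) (a : 'I_n -> A) m :
  coef (\sum_(i < n) c i *: a i) m = \sum_(i < n) c i * coef (a i) m.
Proof.
elim: n c a => [|n IH] c a; first by rewrite !big_ord0 entry0.
by rewrite !big_ord_recr /= entryD entryZ IH.
Qed.

Lemma entry_ext a b : (forall m, coef a m = coef b m) -> a = b.
Proof. by case: hA => _ _ inj _ ab; apply/inj/funext. Qed.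

Lemma entry_continuous m : continuous ((fun a => coef a m) : A -> K^o).
Proof. by case: hA => _ _ _ []. Qed.

Lemma finite_sequence (s : nat -> K) d : (forall m, (d <= m)%N -> s m = 0) ->
  exists a, forall m, coef a m = s m.
Proof.
move=> sd; case: hA => _ _ _ [_ /(_ s) fs _].
have [|a as_] := fs; last by exists a => m; rewrite as_.
apply: (sub_finite_set _ (finite_II d)) => m /= sm.
by rewrite ltnNge; apply: contra sm => /sd ->.
Qed.

Lemma linear_subspace_tail_space d : linear_subspace (tail_space coef d).
Proof.
split=> [m _|c u v du dv m md]; first exact: entry0.
by rewrite entry_linear du// dv// mulr0 addr0.
Qed.

Lemma tail_space_mono d e : (d <= e)%N ->
  tail_space coef e `<=` tail_space coef d.
Proof. by move=> de a ea m md; apply: ea; exact: leq_trans de. Qed.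

(** [d] linear equations cut out an infinite-dimensional, hence nonzero, part of
    an infinite-dimensional subspace. *)
Lemma tail_space_neq0 W d : linear_subspace W -> ~ finite_dim W ->
  exists a, [/\ W a, tail_space coef d a & a != 0].
Proof.
move=> lW nW.
have : ~ finite_dim (W `&` tail_space coef d).
  elim: d => [|d IH].
    by rewrite (_ : tail_space coef 0 = setT) ?setIT//; apply/seteqP.
  rewrite (_ : tail_space coef d.+1 =
      tail_space coef d `&` [set a | coef a d = 0]).
    rewrite setIA.
    apply: infinite_dim_ker => // [|c u v]; last exact: entry_linear.
    have [t0 tP] := linear_subspace_tail_space d.
    split=> [|c u v [Wu tu] [Wv tv]]; first by split=> //; exact: lW.1.
    by split; [exact: lW.2|exact: tP].
  apply/seteqP; split=> [a ad|a [ad ad0] m].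
    split; first exact: tail_space_mono ad.
    exact: ad.
  by rewrite ltnS leq_eqVlt => /predU1P[->|/ad].
move=> nWd; apply: contrapT => none; apply: nWd; exists set0 => //.
apply/seteqP; split=> [a [Wa da]|].
  have -> : a = 0 by apply: contrapT => /eqP a0; apply: none; exists a.
  exact: lspan0.
apply: lspan_min => //.
split=> [|c u v [Wu tu] [Wv tv]].
  split; first exact: lW.1.
  exact: (linear_subspace_tail_space d).1.
by split; [exact: lW.2|exact: (linear_subspace_tail_space d).2].
Qed.

Context {p : nat -> A -> K} (hp : topology_given_by p).

(** A continuous linear form is dominated by one of the seminorms, hence it
    vanishes on its kernel. *)
Lemma seminorm_ker_entry m :
  exists n, forall j, (n <= j)%N -> forall a, p j a = 0 -> coef a m = 0.
Proof.
have : \forall a \near (0 : A), `|coef 0 m - coef a m| < 1.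
  by have /cvgrPdist_lt := @entry_continuous m 0; exact.
move=> /(nbhs_seminormP hp)[n [e [e0 ne]]].
exists n => j nj a /(seminorm_ker_mono hp nj) pa.
apply/eqP; apply: contraT => am.
have := ne ((coef a m)^-1 *: a); rewrite subr0.
rewrite (seminormZ (topology_seminorm hp n)) pa mulr0 entry0 sub0r entryZ.
by rewrite mulVf// normrN1 ltxx => /(_ e0).
Qed.

Context (hker : forall n, finite_codim (seminorm_ker (p n))).

(** A Mittag-Leffler argument: once the chain of the tail spaces is stable
    modulo each kernel, [a] can be corrected by elements of smaller and smaller
    kernels so that its order tends to infinity.  The corrected vectors converge
    to a vector that agrees with [a] modulo [ker p_n] and whose coordinates all
    vanish. *)
Lemma tail_space_sub_ker n :
  exists d, tail_space coef d `<=` seminorm_ker (p n).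
Proof.
have stable j : exists d, forall e h, tail_space coef d h ->
    exists2 g, tail_space coef e g & p j (h - g) = 0.
  apply: (@finite_codim_chain_stable _ _ (seminorm_ker (p j))).
  - exact: linear_subspace_seminorm_ker (topology_seminorm hp j).
  - exact: hker.
  - exact: linear_subspace_tail_space.
  exact: tail_space_mono.
have /choice[d dP] := stable.
exists (d n) => a ad; rewrite /seminorm_ker /=.
(* The order is also raised to j + 1 at each step, since nothing forces the
   thresholds d j themselves to tend to infinity. *)
have /choice[f fP] : forall jh : nat * A, exists g,
    tail_space coef (d jh.1) jh.2 ->
    tail_space coef (maxn (d jh.1.+1) jh.1.+1) g /\ p jh.1 (g - jh.2) = 0.
  move=> [j h].
  have [dh|ndh] := pselect (tail_space coef (d j) h); last by exists 0.
  have [g gt hg] := dP j (maxn (d j.+1) j.+1) h dh.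
  by exists g => _; split; rewrite // (seminormB (topology_seminorm hp j)).
pose u := fix u i := if i is i'.+1 then f ((n + i')%N, u i') else a.
have ud i : tail_space coef (d (n + i)%N) (u i).
  elim: i => [|i IH]; first by rewrite addn0.
  rewrite addnS /=; have [+ _] := fP ((n + i)%N, u i) IH.
  by apply: tail_space_mono; exact: leq_maxl.
have u0 i : tail_space coef i (u i).
  case: i => [//|i] /=; have [+ _] := fP ((n + i)%N, u i) (ud i).
  by apply: tail_space_mono; rewrite leq_max /= ltnS leq_addl orbT.
(* Shifted, so that the j-th difference is controlled by the j-th seminorm. *)
have [||l lu] := @limit_mod_kernels _ _ _ hp (fun j => u (j - n)%N).
- by case: hA => -[].
- move=> j; have [nj|jn] := leqP n j.
    have [_] := fP ((n + (j - n))%N, u (j - n)%N) (ud (j - n)%N).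
    by rewrite subSn//= subnKC.
  have -> : (j.+1 - n = j - n)%N.
    by move: jn (ltnW jn); rewrite -!subn_eq0 => /eqP -> /eqP ->.
  by rewrite subrr (seminorm0 (topology_seminorm hp j)).
have l0 : l = 0.
  apply: entry_ext => m; rewrite entry0.
  have [k km] := seminorm_ker_entry m.
  have := km (n + maxn k m.+1)%N _ _ (lu (n + maxn k m.+1)%N).
  rewrite addKn entryB (u0 (maxn k m.+1)) ?leq_maxr// subr0; apply.
  by rewrite (leq_trans (leq_maxl k m.+1))// leq_addl.
by have := lu n; rewrite l0 subnn sub0r (seminormN (topology_seminorm hp n)).
Qed.

Lemma entries_surjective (s : nat -> K) : exists a, forall m, coef a m = s m.
Proof.
have /choice[d dP] := tail_space_sub_ker.
(* The thresholds are made increasing; the summand n makes them unbounded. *)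
pose D n := (n + \sum_(i < n.+1) d i)%N.
have Dle n : (D n <= D n.+1)%N.
  by rewrite /D [X in (_ <= _ + X)%N]big_ord_recr /= leq_add// leq_addr.
have /choice[v vs] : forall n, exists a, forall m,
    coef a m = if (m < D n)%N then s m else 0.
  by move=> n; apply: (@finite_sequence _ (D n)) => m; rewrite ltnNge => ->.
have [||l lv] := @limit_mod_kernels _ _ _ hp v.
- by case: hA => -[].
- move=> n; apply: dP => m md; rewrite entryB !vs.
  have mD : (m < D n)%N.
    by rewrite (leq_trans md)// /D big_ord_recr /= addnA leq_addl.
  by rewrite mD (leq_trans mD (Dle n)) subrr.
exists l => m; have [k km] := seminorm_ker_entry m.
have := km (maxn k m.+1) (leq_maxl _ _) _ (lv _).
rewrite entryB vs ifT; first by move/subr0_eq.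
by rewrite (leq_trans (leq_maxr k m.+1))// /D leq_addr.
Qed.

Lemma closed_entries_approx W a : closed W ->
  (forall d, exists2 w, W w & forall m, (m < d)%N -> coef w m = coef a m) ->
  W a.
Proof.
move=> cW Wa; apply: cW => U /(nbhs_seminormP hp)[n [e [e0 eU]]].
have [d dn] := tail_space_sub_ker n; have [w Ww wa] := Wa d.
exists w; split => //; apply: eU; rewrite (dn (w - a)) // => m md.
by rewrite entryB wa// subrr.
Qed.

End SequenceSpace.

(** * Necessity: a large multiple at each step *)

Section NormTopology.
Set Implicit Arguments.
Unset Strict Implicit.
Context {K : numFieldType} {X : topologicalLmodType K} {nrm : X -> K}.
Context (norm_nrm : norm nrm) (cont_nrm : continuous (nrm : X -> K^o)).

Lemma norm_gt0 u : u != 0 -> 0 < nrm u.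
Proof.
move=> u0; rewrite lt0r (seminorm_ge0 norm_nrm.1) andbT.
by apply: contra u0 => /eqP /norm_nrm.2 ->.
Qed.

Lemma open_norm_ball b : open [set u | nrm u < b].
Proof.
rewrite openE => u /= ub; rewrite /interior.
have /cvgrPdist_lt /(_ (b - nrm u)) := @cont_nrm u.
rewrite subr_gt0 => /(_ ub); apply: filterS => t /=.
rewrite distrC => ut; rewrite -(ltrD2r (- nrm u)); apply: le_lt_trans ut.
by rewrite real_ler_norm// rpredB// ger0_real// (seminorm_ge0 norm_nrm.1).
Qed.

Lemma nbhs_neq0 (u : X) : u != 0 -> nbhs u [set t | t != 0].
Proof.
move=> u0; have /cvgrPdist_lt /(_ _ (norm_gt0 u0)) := @cont_nrm u.
apply: filterS => t /=; apply: contraTneq => ->.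
rewrite (seminorm0 norm_nrm.1) subr0 ger0_norm ?ltxx//.
exact: (seminorm_ge0 norm_nrm.1).
Qed.

End NormTopology.

Section PartialSums.
Set Implicit Arguments.
Unset Strict Implicit.
Context {K : numFieldType} {A X : topologicalLmodType K} {coef : A -> nat -> K}.
Context (hA : frechet_sequence_space coef) (x : nat -> X).
Local Notation S := (partial_sum coef x).

Lemma partial_sumP k c a b : S k (c *: a + b) = c *: S k a + S k b.
Proof.
rewrite /partial_sum scaler_sumr -big_split; apply: eq_bigr => n _ /=.
by rewrite (entry_linear hA) scalerDl scalerA.
Qed.

Lemma eq_partial_sum k a b : (forall m, (m <= k)%N -> coef a m = coef b m) ->
  S k a = S k b.
Proof. by move=> ab; apply: eq_bigr => i _; rewrite ab// -ltnS. Qed.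

Lemma partial_sum0 k : S k 0 = 0.
Proof. by apply: big1 => i _; rewrite (entry0 hA) scale0r. Qed.

Lemma partial_sum_tail d k a : (k < d)%N -> tail_space coef d a -> S k a = 0.
Proof.
move=> kd ad; rewrite -(partial_sum0 k); apply: eq_partial_sum => m mk.
by rewrite ad ?(entry0 hA)// (leq_ltn_trans mk).
Qed.

Lemma lspan_partial_sum N k a : tail_space coef N a ->
  lspan (x @` [set j | (N <= j <= k)%N]) (S k a).
Proof.
move=> aN; rewrite /partial_sum.
rewrite (bigID (fun j : 'I_k.+1 => (N <= j)%N)) /= [X in _ + X]big1 ?addr0.
  apply: linear_subspace_sum; first exact: linear_subspace_lspan.
  by move=> i Ni; apply: lspan_sub; exists i => //=; rewrite Ni -ltnS ltn_ord.
by move=> i; rewrite -ltnNge => /aN ->; rewrite scale0r.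
Qed.

Lemma lspan_partial_sumB k m a : (k <= m)%N ->
  lspan (x @` [set j | (k.+1 <= j)%N]) (S m a - S k a).
Proof.
elim: m => [|m IH].
  by rewrite leqn0 => /eqP ->; rewrite subrr; exact: lspan0.
rewrite leq_eqVlt => /predU1P[->|]; first by rewrite subrr; exact: lspan0.
rewrite ltnS => km; rewrite /partial_sum big_ord_recr /= addrAC addrC.
apply: (linear_subspace_lspan _).2; last exact: IH.
by apply: lspan_sub; exists m.+1.
Qed.

End PartialSums.

Section Necessity.
Set Implicit Arguments.
Unset Strict Implicit.
Context {K : numFieldType} {A X : topologicalLmodType K} {coef : A -> nat -> K}.
Context (hA : frechet_sequence_space coef) (x : nat -> X).
Context {p : nat -> A -> K} (hp : topology_given_by p).
Context (hker : forall n, finite_codim (seminorm_ker (p n))).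
Context {nrm : X -> K} (norm_nrm : norm nrm)
  (cont_nrm : continuous (nrm : X -> K^o)).
Local Notation S := (partial_sum coef x).

(** If [S m u = 0], then [S k u] is the opposite of [S m u - S k u], a
    combination of the [x j] with [k < j], whereas it belongs to the avoided
    set. *)
Lemma eventually_nonzero N (O : set X) u :
  open O -> O !=set0 ->
  (forall M y, (N <= M)%N -> O y -> lspan (x @` [set k | (N <= k <= M)%N]) y ->
    ~ lspan (x @` [set k | (M.+1 <= k)%N]) y) ->
  tail_space coef N u -> hypercyclic_vector S u ->
  exists k, forall m, (k <= m)%N -> S m u != 0.
Proof.
move=> opO O0 avoid uN hu; have [y [Oy [k _ yE]]] := hu O O0 opO.
rewrite -yE in Oy; have [kN|Nk] := ltnP k N.
  by case: (avoid N (S k u)) => //; rewrite (partial_sum_tail hA x kN uN);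
    exact: lspan0.
exists k => m km; apply/eqP => Sm.
apply: (avoid k (S k u)) => //; first exact: lspan_partial_sum.
rewrite -[S k u]opprK -[- S k u]add0r -Sm.
apply: linear_subspaceN; first exact: linear_subspace_lspan.
exact: lspan_partial_sumB.
Qed.

Lemma large_multiple n (b : K) (y z : nat -> X) : 0 <= b ->
  exists c : K, forall i, (i < n)%N -> z i != 0 -> b <= nrm (y i + c *: z i).
Proof.
move=> b0; have sn := norm_nrm.1.
pose t i := (b + nrm (y i)) / nrm (z i).
have t0 i : 0 <= t i by rewrite divr_ge0 ?addr_ge0 ?(seminorm_ge0 sn).
(* Scalars need not be comparable: the sum of the individual bounds replaces
   their maximum. *)
exists (\sum_(j < n) t j) => i ir zi.
have ti : t i <= \sum_(j < n) t j.
  by rewrite (bigD1 (Ordinal ir))//= lerDl sumr_ge0.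
rewrite -(lerD2r (nrm (y i))).
apply: (@le_trans _ _ (nrm ((\sum_(j < n) t j) *: z i))).
  rewrite (seminormZ sn) ger0_norm ?sumr_ge0//.
  by rewrite -ler_pdivrMr// (norm_gt0 norm_nrm).
have := seminorm_triangle sn (- y i) ((\sum_(j < n) t j) *: z i) 0.
by rewrite !subr0 opprK (seminormN sn) [_ + y i]addrC.
Qed.

(** Otherwise a series of larger and larger multiples of vectors of [W] is a
    nonzero vector of [W] whose partial sums are all zero or of large norm;
    these sums are not dense. *)
Lemma hypercyclic_subspace_dense_spans W N : hypercyclic_subspace S W ->
  dense (\bigcup_(M in [set M | (N <= M)%N])
       (lspan (x @` [set k | (N <= k <= M)%N]) `&`
        lspan (x @` [set k | (M.+1 <= k)%N]))).
Proof.
move=> [lW cW nW hcW] O O0 opO; apply: contrapT => meet.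
have avoid M y : (N <= M)%N -> O y ->
    lspan (x @` [set k | (N <= k <= M)%N]) y ->
    ~ lspan (x @` [set k | (M.+1 <= k)%N]) y.
  by move=> NM Oy y1 y2; apply: meet; exists y; split => //; exists M.
have O_neq0 : ~ O 0.
  by move=> O00; apply: (avoid N 0 (leqnn N) O00); exact: lspan0.
(* The ball of radius b still meets O, namely at y. *)
have [y Oy] := O0; pose b := nrm y + 1.
have b0 : 0 < b by rewrite ltr_wpDl// (seminorm_ge0 norm_nrm.1).
have /choice[u uP] : forall j, exists u,
    [/\ W u, tail_space coef (N + j) u & u != 0].
  by move=> j; exact: (tail_space_neq0 hA).
have /choice[k kP] : forall j, exists k, forall m, (k <= m)%N -> S m (u j) != 0.
  move=> j; have [Wu tu u0] := uP j.
  apply: (eventually_nonzero opO O0 avoid); last exact: hcW.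
  by apply: tail_space_mono tu; exact: leq_addr.
(* From the index k (j + 1) on, the next vector u (j + 1) has nonzero partial
   sums and takes over; only the earlier indices are left to c. *)
have /choice[c cP] : forall ja : nat * A, exists c : K, forall m,
    (m < k ja.1.+1)%N -> S m (u ja.1) != 0 ->
    b <= nrm (S m ja.2 + c *: S m (u ja.1)).
  move=> [j a] /=.
  exact: (large_multiple _ (fun m => S m a) (fun m => S m (u j)) (ltW b0)).
pose v := fix v j := if j is i.+1 then c (i, v i) *: u i + v i else 0.
have Wv j : W (v j).
  elim: j => [|j IH] /=; first exact: linear_subspace0.
  by apply: lW.2 => //; case: (uP j).
have coefv m j : (m < j)%N -> coef (v j) m = coef (v m.+1) m.
  elim: j => [//|j IH]; rewrite ltnS leq_eqVlt => /predU1P[->//|mj].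
  rewrite [v j.+1]/= (entry_linear hA) IH//; case: (uP j) => _ -> //.
    by rewrite mulr0 add0r.
  by rewrite (leq_trans mj)// leq_addl.
have [a av] := entries_surjective hA hp hker (fun m => coef (v m.+1) m).
have Wa : W a.
  apply: (closed_entries_approx hA hp hker cW) => d; exists (v d) => // m md.
  by rewrite av coefv.
have Sa m : S m a = S m (v m.+1).
  by apply: eq_partial_sum => i im; rewrite av [RHS]coefv.
have Su m : S m (u m.+1) = 0.
  case: (uP m.+1) => _ tu _; apply: (partial_sum_tail hA x _ tu).
  exact: leq_addl.
(* The last vector whose m-th partial sum is not zero makes the sum large. *)
have zero_or_large m d : S m (u d) = 0 ->
    (forall i, (i < d)%N -> S m (u i) = 0) /\ S m (v d) = 0 \/
    b <= nrm (S m (v d)).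
  elim: d => [_|d IH ud1].
    by left; split => //; exact: partial_sum0.
  have [ud|ud] := eqVneq (S m (u d)) 0.
    rewrite /= (partial_sumP hA) ud scaler0 add0r.
    have [[ui vd]|] := IH ud; [left|by right].
    by split => // i; rewrite ltnS leq_eqVlt => /predU1P[->//|/ui].
  right; rewrite /= (partial_sumP hA) addrC; apply: (cP (d, v d)) => //=.
  by rewrite ltnNge; apply/negP => /kP; rewrite ud1 eqxx.
have a0 : a != 0.
  apply/eqP => a0; have [[+ _]|] := zero_or_large _ _ (Su (k 0%N)).
    by move=> /(_ 0%N isT)/eqP; apply/negP/kP.
  rewrite -Sa a0 (partial_sum0 hA) (seminorm0 norm_nrm.1) => /(lt_le_trans b0).
  by rewrite ltxx.
have [|z [[Oz zb] [m _ zE]]] :=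
    hcW a Wa a0 (O `&` [set z | nrm z < b]) _
      (openI opO (open_norm_ball norm_nrm cont_nrm b)).
  by exists y; split => //=; rewrite /b ltrDl.
move: Oz zb; rewrite -zE Sa => Oz /= zb.
have [[_ v0]|bv] := zero_or_large _ _ (Su m); first by rewrite v0 in Oz.
by have := lt_le_trans zb bv; rewrite ltxx.
Qed.

End Necessity.

(** * A subspace of sequences proportional to a fixed one on each class *)

Section BlockSubspace.
Set Implicit Arguments.
Unset Strict Implicit.
Context {K : numFieldType} {A : topologicalLmodType K} {coef : A -> nat -> K}.
Context (hA : frechet_sequence_space coef).
Context (surj : forall s : nat -> K, exists a, forall m, coef a m = s m).
Context (class rep : nat -> nat) (v : nat -> K).
Context (class_rep : forall i, class (rep i) = i)
  (v_rep : forall i, v (rep i) != 0).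

(** On each class the sequence is a multiple of [v].  The multiplier is read off
    at the representative of the class, so that each condition is a linear
    equation between two coordinates. *)
Definition block_subspace : set A :=
  [set a | forall m,
    coef a m = coef a (rep (class m)) / v (rep (class m)) * v m].

Lemma block_subspace_linear : linear_subspace block_subspace.
Proof.
split=> [m|c a b Wa Wb m]; first by rewrite !(entry0 hA) !mul0r.
by rewrite !(entry_linear hA) [in LHS]Wa [in LHS]Wb !mulrDl !mulrA.
Qed.

Lemma block_subspace_closed : closed block_subspace.
Proof.
move=> a cla m; apply/subr0_eq/eqP; apply: contraT => neq.
pose f (t : A) : K :=
  coef t m - coef t (rep (class m)) * ((v (rep (class m)))^-1 * v m).
have f_cont : continuous (f : A -> K^o).
  move=> t; apply: (@cvgB K K^o); first exact: (entry_continuous hA).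
  by apply: cvgMr_tmp; exact: (entry_continuous hA).
have fE t : coef t m - coef t (rep (class m)) / v (rep (class m)) * v m = f t.
  by rewrite /f mulrA.
rewrite fE -normr_gt0 in neq.
have /cvgrPdist_lt /(_ _ neq) := f_cont a.
move=> /cla[t [/(_ m) /eqP]]; rewrite -subr_eq0 fE => /eqP ->.
by rewrite /= subr0 ltxx.
Qed.

Lemma block_subspace_infinite_dim : ~ finite_dim block_subspace.
Proof.
move=> [B /lspan_finite_dependent[b dep] WB].
have /choice[u uP] : forall i, exists a, forall m,
    coef a m = (class m == i)%:R * v m.
  by move=> i; exact: surj.
have [|c [i ci]] := dep (fun i : 'I_b => u i).
  move=> i; rewrite -WB => m; rewrite !uP class_rep mulfK//.
move=> /(congr1 (fun a => coef a (rep i))).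
rewrite (entry_sum hA) (entry0 hA) (bigD1 i)//= uP class_rep eqxx mul1r big1.
  by rewrite addr0 => /eqP; rewrite mulf_eq0 (negPf ci) (negPf (v_rep i)).
move=> j ji; rewrite uP class_rep.
by rewrite [_ == _ :> nat](negPf _) ?mul0r ?mulr0// eq_sym.
Qed.

End BlockSubspace.

(** * Blocks with sum zero *)

Section FiniteSums.
Set Implicit Arguments.
Unset Strict Implicit.
Context {K : numFieldType} {X : lmodType K} (x : nat -> X).

Lemma sum_finite_support (s : nat -> K) d e : (d <= e)%N ->
  (forall m, (d <= m)%N -> s m = 0) ->
  \sum_(m < e) s m *: x m = \sum_(m < d) s m *: x m.
Proof.
move=> de sd; elim: e de => [|e IH]; first by rewrite leqn0 => /eqP ->.
rewrite leq_eqVlt => /predU1P[->//|]; rewrite ltnS => de.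
by rewrite big_ord_recr /= sd// scale0r addr0 IH.
Qed.

Lemma lspan_image_coefficients (D : set nat) y : lspan (x @` D) y ->
  exists d (s : nat -> K), [/\ forall m, ~ D m -> s m = 0,
    forall m, (d <= m)%N -> s m = 0 & y = \sum_(m < d) s m *: x m].
Proof.
move: y; apply: lspan_min => [|_ [k Dk <-]].
  split; first by exists 0%N, (fun=> 0); split => //; rewrite big_ord0.
  move=> c y1 y2 [d [s [sD sd ->]]] [e [t [tD te ->]]].
  exists (maxn d e), (fun m => c * s m + t m); split.
  - by move=> m Dm; rewrite sD// tD// mulr0 addr0.
  - by move=> m; rewrite geq_max => /andP[dm em]; rewrite sd// te// mulr0 addr0.
  rewrite -(sum_finite_support (leq_maxl d e) sd).
  rewrite -(sum_finite_support (leq_maxr d e) te).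
  rewrite scaler_sumr -big_split; apply: eq_bigr => m _ /=.
  by rewrite scalerDl scalerA.
exists k.+1, (fun m => (m == k)%:R); split.
- by move=> m Dm; case: eqP => // mk; rewrite mk in Dm.
- by move=> m km; case: eqP => // mk; rewrite mk ltnn in km.
rewrite big_ord_recr /= eqxx scale1r big1 ?add0r// => i _.
by rewrite (ltn_eqF (ltn_ord i)) scale0r.
Qed.

(** A vector is written both on the indices [N..M] and on indices after [M]:
    the difference of the two expressions sums to zero, and its partial sum at
    [M] is the vector. *)
Lemma block_exists N (O : set X) :
  \bigcup_(M in [set M | (N <= M)%N])
       (lspan (x @` [set k | (N <= k <= M)%N]) `&`
        lspan (x @` [set k | (M.+1 <= k)%N])) `&` O !=set0 ->
  exists MLP : nat * nat * (nat -> K), let: (M, L, P) := MLP in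
    [/\ (N <= M < L)%N, forall m, (m < N)%N -> P m = 0,
      O (\sum_(m < M.+1) P m *: x m) & \sum_(m < L) P m *: x m = 0].
Proof.
move=> [y [[M /= NM [y1 y2]] Oy]].
have [d [s [sD sd ys]]] := lspan_image_coefficients y1.
have [e [t [tD te yt]]] := lspan_image_coefficients y2.
exists (M, maxn M.+1 e, fun m => s m - t m).
have sM m : (M.+1 <= m)%N -> s m = 0.
  by move=> Mm; apply: sD => /= /andP[_]; rewrite leqNgt Mm.
have ysM : y = \sum_(m < M.+1) s m *: x m.
  rewrite -(sum_finite_support (leq_maxl M.+1 d) sM) ys.
  by rewrite (sum_finite_support (leq_maxr M.+1 d) sd).
have tM m : (m < M.+1)%N -> t m = 0.
  by move=> mM; apply: tD => /=; rewrite leqNgt mM.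
split.
- by rewrite NM leq_maxl.
- move=> m mN; rewrite sD ?tM ?subr0//=; last by rewrite leqNgt mN.
  by rewrite (leq_trans mN)// leqW.
- rewrite (eq_bigr (fun m : 'I_M.+1 => s m *: x m)) -?ysM// => m _.
  by rewrite tM// subr0.
rewrite (eq_bigr (fun m : 'I__ => s m *: x m - t m *: x m)); last first.
  by move=> m _; rewrite scalerBl.
rewrite sumrB (sum_finite_support (leq_maxl M.+1 e) sM) -ysM.
by rewrite (sum_finite_support (leq_maxr M.+1 e) te) -yt subrr.
Qed.

End FiniteSums.

(** * Sufficiency: concatenating blocks *)

Section Sufficiency.
Set Implicit Arguments.
Unset Strict Implicit.

Lemma inv_nat_small (R : realType) (K : numFieldType) :
  K = (R : numFieldType) \/ K = (R[i] : numFieldType) ->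
  forall e : K, 0 < e -> exists t : nat, t.+1%:R^-1 < e.
Proof.
have aR (e : R) : 0 < e -> exists t : nat, t.+1%:R^-1 < e.
  move=> e0; exists (Num.bound e^-1); rewrite invf_plt ?posrE//.
  rewrite (lt_le_trans (archi_boundP _)) ?ler_nat// invr_ge0 ltW//.
case=> -> // e; rewrite ltcE /= => /andP[/eqP ei er].
have [t te] := aR _ er; exists t.
rewrite (_ : e = (complex.Re e)%:C%C); last by case: e ei {er te} => a b /= ->.
by rewrite (_ : _^-1 = (t.+1%:R^-1)%:C%C) ?ltcR// fmorphV rmorph_nat.
Qed.

Context {K : numFieldType} {X : topologicalLmodType K}.

Lemma separable_sequence : separable X -> exists y : nat -> X, dense (range y).
Proof.
move=> [D cD dD].
have [f] : $|{surjfun [set: nat] >-> D}|.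
  have [D0|//] := pfcard_geP cD.
  have [//|z] := dD setT _ openT; first by exists 0.
  by rewrite D0 setI0.
exists f => O O0 opO; have [z [Oz Dz]] := dD O O0 opO.
exists z; split => //; exact: (@surj _ _ _ _ f).
Qed.

Lemma dense_approximation (q : nat -> X -> K) (y : nat -> X)
    (z : nat * nat -> X) :
  topology_given_by q ->
  (forall e : K, 0 < e -> exists t : nat, t.+1%:R^-1 < e) ->
  dense (range y) -> (forall r t, q t (z (r, t) - y r) < t.+1%:R^-1) ->
  dense (range z).
Proof.
move=> hq arch dy zy O O0 opO; have [w [Ow [r _ yr]]] := dy O O0 opO.
have /(nbhs_seminormP hq)[n [e [e0 eO]]] := open_nbhs_nbhs (conj opO Ow).
have [t te] := arch e e0.
exists (z (r, maxn n t)); split; last by exists (r, maxn n t).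
apply: eO; rewrite -yr (le_lt_trans (le_seminorm hq _ (leq_maxl n t)))//.
rewrite (lt_trans (zy _ _))// (le_lt_trans _ te)//.
by rewrite lef_pV2 ?posrE// ler_nat ltnS leq_maxr.
Qed.

Lemma dense_scale (T : Type) (z : T -> X) (c : K) : c != 0 ->
  dense (range z) -> dense (range (fun t => c *: z t)).
Proof.
move=> c0 dz O [u Ou] opO.
have cont : continuous (fun u : X => c *: u).
  move=> t; apply: (@continuous_comp _ (K^o * X)%type _ (fun t => (c, t))
    (fun cv : K^o * X => cv.1 *: cv.2)); last exact: scale_continuous.
  apply: (@cvg_pair _ _ _ _ (nbhs (c : K^o))); first exact: cvg_cst.
  exact: cvg_id.
have [||w [Ow [t _ zw]]] := dz ((fun u : X => c *: u) @^-1` O).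
- by exists (c^-1 *: u); rewrite /= scalerA mulfV// scale1r.
- by apply: open_comp => // t _; exact: cont.
by exists (c *: w); split => //; exists t; rewrite ?zw.
Qed.

Context {A : topologicalLmodType K} {coef : A -> nat -> K} (x : nat -> X).
Context (hA : frechet_sequence_space coef).
Context (surj : forall s : nat -> K, exists a, forall m, coef a m = s m).
Local Notation S := (partial_sum coef x).

(** If [X = 0] the blocks may vanish, so they cannot be used; there every vector
    is hypercyclic. *)
Lemma hypercyclic_subspace_trivial : (forall y : X, y = 0) ->
  exists W : set A, hypercyclic_subspace S W.
Proof.
move=> X0; have one_neq0 (i : nat) : (1 : K) != 0 by exact: oner_neq0.
exists (block_subspace (coef := coef) id id (fun=> 1)); split.
- exact: block_subspace_linear.
- exact: block_subspace_closed.
- exact: (block_subspace_infinite_dim hA surj).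
move=> a _ _ O [u Ou] _; exists u; split => //.
by exists 0%N => //; rewrite [u]X0; exact: X0.
Qed.

(** The [s]-th block occupies the indices from [start s] to [start (s + 1)]; its
    partial sum up to [mid s] is within [1 / (t + 1)] of [y r] for the [t]-th
    seminorm, where [s] encodes the class [i] of the block and the pair
    [(r, t)]. *)
Lemma dense_spans_hypercyclic_subspace (q : nat -> X -> K) (nrm : X -> K) :
  topology_given_by q -> norm nrm -> continuous (nrm : X -> K^o) ->
  (forall e : K, 0 < e -> exists t : nat, t.+1%:R^-1 < e) ->
  separable X ->
  (forall N : nat,
     dense (\bigcup_(M in [set M | (N <= M)%N])
       (lspan (x @` [set k | (N <= k <= M)%N]) `&`
        lspan (x @` [set k | (M.+1 <= k)%N])))) ->
  exists W : set A, hypercyclic_subspace S W.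
Proof.
move=> hq norm_nrm cont_nrm arch /separable_sequence[y dy] dspan.
have [[y0 y0_neq0]|X0] := pselect (exists u : X, u != 0); last first.
  apply: hypercyclic_subspace_trivial => u; apply/eqP; apply: contraT => u0.
  by case: X0; exists u.
pose code s : nat * (nat * nat) := odflt (0, (0, 0))%N (unpickle s).
have codeK c : code (pickle c) = c by rewrite /code pickleK.
pose target (rt : nat * nat) := [set u | q rt.2 (u - y rt.1) < rt.2.+1%:R^-1].
have block sN : exists MLP : nat * nat * (nat -> K), let: (M, L, P) := MLP in
    [/\ (sN.2 <= M < L)%N, forall m, (m < sN.2)%N -> P m = 0,
      (target (code sN.1).2)° (\sum_(m < M.+1) P m *: x m) &
      \sum_(m < L) P m *: x m = 0].
  apply: block_exists; rewrite setIC.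
  apply: dspan; last exact: open_interior.
  exists (y (code sN.1).2.1); apply/(nbhs_seminormP hq).
  exists (code sN.1).2.2, (code sN.1).2.2.+1%:R^-1.
  by rewrite invr_gt0 ltr0Sn; split.
have /choice[B BP] := block.
pose start := fix start s := if s is s'.+1 then (B (s', start s')).1.2 else 0%N.
pose mid s := (B (s, start s)).1.1.
pose P s := (B (s, start s)).2.
have blockP s : [/\ (start s <= mid s < start s.+1)%N,
    forall m, (m < start s)%N -> P s m = 0,
    target (code s).2 (\sum_(m < (mid s).+1) P s m *: x m) &
    \sum_(m < start s.+1) P s m *: x m = 0].
  rewrite /mid /P /=; have := BP (s, start s).
  case: (B (s, start s)) => -[M L] Q /= [? ? ? ?]; split => //.
  exact: interior_subset.
have start0 : start 0%N = 0%N by [].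
clearbody start mid P.
have start_lt s : (start s < start s.+1)%N.
  by have [/andP[sm ms] _ _ _] := blockP s; exact: leq_ltn_trans ms.
have start_mono s s' : (s <= s')%N -> (start s <= start s')%N.
  by apply: (homo_leq leqnn leq_trans) => i; exact: ltnW.
have le_start s : (s <= start s)%N.
  by elim: s => // s IH; exact: leq_ltn_trans (start_lt s).
have /choice[blk blkP] : forall m, exists s, (start s <= m < start s.+1)%N.
  move=> m; have sm s : (start s <= m)%N -> (s <= m)%N by exact: leq_trans.
  have ex0 : exists s, (start s <= m)%N by exists 0%N; rewrite start0.
  case: (ex_maxnP ex0 sm) => s sm' smax; exists s; rewrite sm' ltnNge.
  by apply/negP => /smax; rewrite ltnn.
have blk_eq s m : (start s <= m < start s.+1)%N -> blk m = s.
  move=> /andP[sm ms]; have /andP[bm mb] := blkP m.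
  apply/eqP; rewrite eqn_leq.
  apply/andP; split; rewrite leqNgt; apply/negP => /start_mono.
    by rewrite leqNgt (leq_ltn_trans bm ms).
  by rewrite leqNgt (leq_ltn_trans sm mb).
pose v m := P (blk m) m.
pose class m := (code (blk m)).1.
pose z s := \sum_(m < (mid s).+1) P s m *: x m.
have dense_z (i : nat) :
    dense (range (fun rt : nat * nat => z (pickle (i, rt)))).
  apply: (dense_approximation hq arch dy) => r t.
  by have [_ _ + _] := blockP (pickle (i, (r, t))); rewrite codeK.
(* As the middle sums of class i are dense in a nonzero space, one of them is
   not zero, and so v does not vanish on the class. *)
have /choice[rep repP] : forall i, exists m, class m = i /\ v m != 0.
  move=> i; have y0nbhs := nbhs_neq0 norm_nrm cont_nrm y0_neq0.
  have [|w [wn0 [rt _ zw]]] :=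
      dense_z i _ _ (open_interior [set u : X | u != 0]).
    by exists y0.
  set s := pickle (i, rt) in zw.
  have zn0 : z s != 0 by rewrite zw; exact: interior_subset wn0.
  have [m [sm Pm]] : exists m, (m <= mid s)%N /\ P s m != 0.
    apply: contrapT => none; move/eqP: zn0; apply.
    apply: big1 => m _; suff /eqP -> : P s m == 0 by rewrite scale0r.
    by apply: contraT => Pm; case: none; exists m; rewrite -ltnS.
  have bm : blk m = s.
    apply: blk_eq; have [/andP[_ ms] P0 _ _] := blockP s.
    rewrite (leq_ltn_trans sm ms) andbT leqNgt; apply: contra Pm => /P0 ->.
    by rewrite eqxx.
  by exists m; rewrite /class /v bm codeK.
have class_rep i : class (rep i) = i by case: (repP i).
have v_rep i : v (rep i) != 0 by case: (repP i).
exists (block_subspace (coef := coef) class rep v); split.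
- exact: block_subspace_linear.
- exact: block_subspace_closed.
- exact: (block_subspace_infinite_dim hA surj class_rep v_rep).
move=> a Wa a0.
pose c i := coef a (rep i) / v (rep i).
(* Complete blocks contribute nothing: only the block containing T remains. *)
have sumE s T : (start s <= T <= start s.+1)%N ->
    \sum_(m < T) coef a m *: x m = c (code s).1 *: \sum_(m < T) P s m *: x m.
  elim: s T => [|s IH] T /andP[sT Ts].
    rewrite scaler_sumr; apply: eq_bigr => m _; rewrite Wa scalerA.
    by rewrite /v /class (blk_eq 0%N)// start0 (leq_trans (ltn_ord m)).
  move: Ts; rewrite -(subnKC sT); move: (T - _)%N => d Td.
  rewrite big_split_ord [in RHS]big_split_ord /=.
  have [_ P0 _ _] := blockP s.+1; have [_ _ _ Ps] := blockP s.
  rewrite IH ?leqnn ?andbT ?start_mono// Ps scaler0 add0r.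
  rewrite [X in _ = _ *: (X + _)]big1 ?add0r => [|m _]; last first.
    by rewrite P0 ?scale0r.
  rewrite scaler_sumr; apply: eq_bigr => m _; rewrite Wa scalerA.
  rewrite /v /class (blk_eq s.+1)// leq_addr /=.
  by rewrite (leq_trans _ Td)// ltn_add2l.
have Smid s : S (mid s) a = c (code s).1 *: z s.
  apply: sumE; have [/andP[sm ms] _ _ _] := blockP s.
  by rewrite leqW.
have [m am] : exists m, coef a m != 0.
  apply: contrapT => none; move/eqP: a0; apply; apply: (entry_ext hA) => m.
  rewrite (entry0 hA); apply/eqP; apply: contraT => am.
  by case: none; exists m.
have cm : c (class m) != 0.
  by apply: contraNneq am => cm; rewrite Wa -/(c _) cm mul0r.
move=> O O0 opO.
have [w [Ow [rt _ zw]]] := dense_scale cm (dense_z (class m)) O0 opO.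
exists w; split => //.
by exists (mid (pickle (class m, rt))); rewrite // Smid codeK.
Qed.

End Sufficiency.

Theorem corollary4p3 (R : realType) (K : numFieldType)
    (hK : K = (R : numFieldType) \/ K = (R[i] : numFieldType))
    (A X : topologicalLmodType K)
    (coef : A -> nat -> K) (hA : frechet_sequence_space coef)
    (p : nat -> A -> K) (hp : topology_given_by p)
    (hX : separable X)
    (q : nat -> X -> K) (hq : topology_given_by q)
    (x : nat -> X)
    (hnorm : has_continuous_norm X)
    (hker : forall n, finite_codim (seminorm_ker (p n))) :
  (exists W : set A, hypercyclic_subspace (partial_sum coef x) W) <->
  (forall N : nat,
     dense (\bigcup_(M in [set M | (N <= M)%N])
       (lspan (x @` [set k | (N <= k <= M)%N]) `&`
        lspan (x @` [set k | (M.+1 <= k)%N])))).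
Proof.
have [nrm norm_nrm cont_nrm] := hnorm; split.
  move=> [W hW] N.
  exact: (hypercyclic_subspace_dense_spans hA hp hker norm_nrm cont_nrm N hW).
move=> dspan.
exact: (dense_spans_hypercyclic_subspace hA (entries_surjective hA hp hker)
  hq norm_nrm cont_nrm (inv_nat_small hK) hX dspan).
Qed.
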